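(* Let $\mathcal{H}$ be a nonzero complex Hilbert space and let $T$ be a bounded linear operator on $\mathcal{H}$ with $\|T\|\leq 1$. Then for every positive integer $n\geq 2$, $$w^n(T) \leq \frac{1}{2^{n-1}} w(T^n) + 1 - \frac{1}{2^{n-1}}.$$ This inequality is sharp, that is, for every integer $n\geq 2$ there is a bounded linear operator $T$ on $\mathcal{H}$ with $\|T\|\leq 1$ for which equality holds.
   Context: For a bounded linear operator $A$ on $\mathcal{H}$, $\|A\|$ denotes the usual operator norm and $w(A)=\sup\{|\langle Ax,x\rangle| : x\in\mathcal{H},\ \|x\|=1\}$ denotes the numerical radius; $w^n(A)$ means $(w(A))^n$. *)

(* Defs.v *)
From HB Require Import structures.
From mathcomp Require Import all_boot all_order all_algebra.
From mathcomp Require Import complex.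
From mathcomp Require Import boolp classical_sets reals topology normedtype.

Set Implicit Arguments.
Unset Strict Implicit.
Unset Printing Implicit Defensive.

Import Order.TTheory GRing.Theory Num.Theory Num.Def.
Import numFieldNormedType.Exports.

Local Open Scope classical_set_scope.
Local Open Scope ring_scope.
Local Open Scope complex_scope.

(* A complex Hilbert space is a complete normed space H over R[i] together with
   a form dot : {dot H for conjC} (linear in its first argument) inducing the
   norm of H. *)
Definition induces_norm (R : realType) (H : completeNormedModType R[i])
    (dot : {dot H for conjC}) : Prop :=
  forall x : H, dot x x = `|x| ^+ 2.

(* Norms over R[i] take their values in R[i], where they are nonnegative reals;
   suprema need values in R. *)
Definition rnorm (R : realType) (V : normedZmodType R[i]) (x : V) : R :=
  complex.Re `|x|.

Definition bounded_operator (R : realType) (H : completeNormedModType R[i])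
    (A : H -> H) : Prop :=
  exists M : R, forall x : H, rnorm (A x) <= M * rnorm x.

Definition opnorm (R : realType) (H : completeNormedModType R[i])
    (A : H -> H) : R :=
  sup [set rnorm (A x) | x in [set x : H | rnorm x <= 1]].

Definition numerical_radius (R : realType) (H : completeNormedModType R[i])
    (dot : {dot H for conjC}) (A : H -> H) : R :=
  sup [set rnorm (dot (A x) x) | x in [set x : H | rnorm x = 1]].

(* Main.v *)
Require Import Defs.
From mathcomp Require Import all_boot all_order all_algebra.
From mathcomp Require Import complex.
From mathcomp Require Import boolp classical_sets reals topology normedtype.
From mathcomp Require Import exp ring.

(** For a unit vector [x] and a contraction [T] the inequality already holds
    pointwise:
      [|<T x, x>| ^ n <= 2 ^ (1 - n) |<T ^ n x, x>| + 1 - 2 ^ (1 - n)],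
    and taking suprema over the unit sphere gives it for the numerical radii.
    The pointwise bound ([dot_contraction_expr_le]) is an induction on [n] whose
    step is Buzano's inequality in the form
      [2 |<z, x>| |<T x, x>| <= |z| + |<T z, x>|]
    applied to [z = T ^ n x] ([contraction_buzano]). Buzano's inequality itself
    expresses that [z |-> 2 <z, x> x - z] is an isometry
    ([norm_line_reflection]): the functional [<T _, x>], of norm at most 1,
    sends the reflected vector to [2 <z, x> <T x, x> - <T z, x>].
    Equality is attained by the identity, all of whose powers have numerical
    radius 1 ([numerical_radius_id]). *)

Set Implicit Arguments.
Unset Strict Implicit.
Unset Printing Implicit Defensive.

Import Order.TTheory GRing.Theory Num.Theory Num.Def.
Import numFieldNormedType.Exports.

Local Open Scope ring_scope.
Local Open Scope complex_scope.

Section PointwiseBound.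

Context (R : realType) (H : completeNormedModType R[i]).
Context (dot : {dot H for conjC}) (dot_norm : induces_norm dot).

(** Where [x] is a unit vector, [z |-> 2 <z, x> x - z] is the reflection
    in the line spanned by [x], hence an isometry. *)
Lemma norm_line_reflection (x z : H) : `|x| = 1 ->
  `|(2 * dot z x) *: x - z| = `|z|.
Proof.
move=> x1; apply/(@pexpIrn _ 2) => //; try exact: normr_ge0.
have xx : dot x x = 1 by rewrite dot_norm x1 expr1n.
rewrite -!dot_norm dnormB dnormZ xx linearZl_LR /=.
have -> : dot x z = conjC (dot z x) by rewrite hermC expr0 mul1r.
have -> : 2 * dot z x * conjC (dot z x) = 2 * `|dot z x| ^+ 2.
  by rewrite normCK mulrA.
rewrite normrM normr_nat rmorphM rmorphXn /= conj_normC conjC_nat.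
ring.
Qed.

(** Cauchy-Schwarz for a unit vector: the projection of [z] on the line of [x]
    is the midpoint of [z] and its reflection, which have equal norms, so the
    triangle inequality bounds it by [|z|]. *)
Lemma dot_unit_le (x z : H) : `|x| = 1 -> `|dot z x| <= `|z|.
Proof.
move=> x1.
have -> : `|dot z x| = `|dot z x *: x| by rewrite normrZ x1 mulr1.
have -> : dot z x *: x = 2^-1 *: (((2 * dot z x) *: x - z) + z).
  by rewrite subrK scalerA mulrA mulVf ?pnatr_eq0 // mul1r.
rewrite normrZ ger0_norm ?invr_ge0 ?ler0n // ler_pdivrMl ?ltr0n //.
apply: le_trans (ler_normD _ _) _.
by rewrite norm_line_reflection // mulr_natl mulr2n.
Qed.

(** Buzano's inequality [2 |<z, x>| |<x, w>| <= |z| |w| + |<z, w>|] for the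
    vector [w] representing the functional [<T _, x>]: apply this functional
    to the reflection of [z]. Writing [T] on the left throughout avoids the
    adjoint of [T], for which [w] is the image of [x]. *)
Lemma contraction_buzano (T : {linear H -> H}) (x z : H) :
    (forall y, `|T y| <= `|y|) -> `|x| = 1 ->
  2 * (`|dot z x| * `|dot (T x) x|) <= `|z| + `|dot (T z) x|.
Proof.
move=> Tle x1; rewrite -normrM -[X in X * _]normr_nat -normrM mulrA.
have -> : 2 * dot z x * dot (T x) x =
    dot (T ((2 * dot z x) *: x - z)) x + dot (T z) x.
  by rewrite linearB linearZ /= linearBl linearZl_LR subrK.
apply: le_trans (ler_normD _ _) _; rewrite lerD2r.
apply: le_trans (dot_unit_le _ x1) _.
by apply: le_trans (Tle _) _; rewrite norm_line_reflection.
Qed.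

Lemma norm_iter_le (T : H -> H) (n : nat) (x : H) :
  (forall y, `|T y| <= `|y|) -> `|iter n T x| <= `|x|.
Proof.
by move=> Tle; elim: n => //= n; apply: le_trans (Tle _).
Qed.

(** Induction on the exponent: multiplying the bound for [m] by
    [|<T x, x>| <= 1] and applying Buzano's inequality to [z = T ^ m x] halves
    the coefficient of the numerical term. *)
Lemma dot_contraction_expr_le (T : {linear H -> H}) (x : H) (m : nat) :
    (forall y, `|T y| <= `|y|) -> `|x| = 1 ->
  `|dot (T x) x| ^+ m.+1 <=
    (2 ^+ m)^-1 * `|dot (iter m.+1 T x) x| + (1 - (2 ^+ m)^-1).
Proof.
move=> Tle x1.
have t1 : `|dot (T x) x| <= 1.
  by rewrite -x1; apply: le_trans (dot_unit_le _ x1) (Tle x).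
elim: m => [|m IHm]; first by rewrite !expr0 invr1 mul1r subrr addr0 expr1.
have half_ge0 k : 0 <= (2 ^+ k)^-1 :> R[i] by rewrite invr_ge0 exprn_ge0.
have half_le1 : 0 <= 1 - (2 ^+ m)^-1 :> R[i].
  by rewrite subr_ge0 invf_le1 ?exprn_gt0 // exprn_ege1 // ler1n.
rewrite exprSr; apply: le_trans (ler_wpM2r (normr_ge0 _) IHm) _.
rewrite mulrDl.
have half2 : (2 ^+ m)^-1 = (2 ^+ m.+1)^-1 * 2 :> R[i].
  by rewrite exprSr invfM -mulrA mulVf ?mulr1 // pnatr_eq0.
(* set aside the part of the bound inherited unchanged from exponent [m.+1] *)
have -> : (2 ^+ m.+1)^-1 * `|dot (iter m.+2 T x) x| + (1 - (2 ^+ m.+1)^-1) =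
    (2 ^+ m.+1)^-1 * (1 + `|dot (iter m.+2 T x) x|) + (1 - (2 ^+ m)^-1).
  by rewrite half2; ring.
apply: lerD; last by rewrite ler_piMr.
rewrite [in X in X <= _]half2 -!mulrA; apply: ler_wpM2l => //.
apply: le_trans (contraction_buzano _ Tle x1) _.
by rewrite lerD2r -x1; apply: norm_iter_le.
Qed.

End PointwiseBound.

Lemma norm_rnorm (R : realType) (V : normedZmodType R[i]) (x : V) :
  `|x| = (rnorm x)%:C.
Proof. by rewrite /rnorm RRe_real // ger0_real. Qed.

Lemma rnorm_ge0 (R : realType) (V : normedZmodType R[i]) (x : V) :
  0 <= rnorm x.
Proof. by rewrite -ler0c -norm_rnorm. Qed.

Lemma rnorm_eq1 (R : realType) (V : normedZmodType R[i]) (x : V) :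
  rnorm x = 1 -> `|x| = 1.
Proof. by rewrite norm_rnorm => ->. Qed.

Lemma exists_unit_vector (R : realType) (H : normedModType R[i]) :
  (exists x : H, x != 0) -> exists x : H, rnorm x = 1.
Proof.
move=> [x x0]; exists (`|x|^-1 *: x).
by rewrite /rnorm normrZ normfV normr_id mulVf // normr_eq0.
Qed.

(** The supremum defining [opnorm] only bounds its elements when it is taken
    over a bounded set, which is what [bounded_operator] provides; homogeneity
    then extends the bound from the unit ball to all vectors. *)
Lemma opnorm_le1_contraction (R : realType) (H : completeNormedModType R[i])
    (T : {linear H -> H}) :
  bounded_operator T -> opnorm T <= 1 -> forall x, `|T x| <= `|x|.
Proof.
move=> [M TM] T1 x; have [->|x0] := eqVneq x 0; first by rewrite linear0.
have nx0 : 0 < `|x| by rewrite normr_gt0.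
set u := `|x|^-1 *: x.
have nu : `|u| = 1 by rewrite normrZ normfV normr_id mulVf // gt_eqF.
have Tu : rnorm (T u) <= 1.
  apply: le_trans T1; apply: ub_le_sup; last first.
    by exists u => //=; rewrite /rnorm nu.
  exists `|M| => _ [y /= y1 <-]; apply: le_trans (TM y) _.
  apply: le_trans (ler_wpM2r (rnorm_ge0 _) (ler_norm M)) _.
  by rewrite ler_piMr.
have xu : x = `|x| *: u by rewrite scalerA mulfV ?scale1r // gt_eqF.
(* [u] is made opaque so that [normrZ] does not expand it *)
clearbody u; rewrite xu linearZ /= !normrZ normr_id nu ler_wpM2l //.
by rewrite norm_rnorm -(rmorph1 (real_complex R)) lecR.
Qed.

Section NumericalRadius.

Context (R : realType) (H : completeNormedModType R[i]).
Context (dot : {dot H for conjC}) (dot_norm : induces_norm dot).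

Lemma dot_le_numerical_radius (A : H -> H) (x : H) :
    (forall y, `|A y| <= `|y|) -> rnorm x = 1 ->
  rnorm (dot (A x) x) <= numerical_radius dot A.
Proof.
move=> Ale x1; apply: ub_le_sup; last by exists x.
exists 1 => _ [y /= /rnorm_eq1 y1 <-].
rewrite -lecR -norm_rnorm rmorph1 -y1.
exact: le_trans (dot_unit_le dot_norm _ y1) (Ale y).
Qed.

(** A power commutes with the supremum because [c |-> c `^ n^-1] is increasing:
    the bound [C `^ n^-1] on the values passes to the supremum. *)
Lemma numerical_radius_expr_le (A : H -> H) (n : nat) (C : R) :
    (0 < n)%N -> (exists x : H, x != 0) ->
    (forall x, rnorm x = 1 -> rnorm (dot (A x) x) ^+ n <= C) ->
  numerical_radius dot A ^+ n <= C.
Proof.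
move=> n0 /exists_unit_vector[x x1] AC.
have n0R : n%:R != 0 :> R by rewrite pnatr_eq0 -lt0n.
have C0 : 0 <= C by apply: le_trans (AC _ x1); rewrite exprn_ge0 // rnorm_ge0.
have root_ub y : rnorm y = 1 -> rnorm (dot (A y) y) <= C `^ n%:R^-1.
  move=> y1; have d0 := rnorm_ge0 (dot (A y) y).
  rewrite -[leLHS](_ : (rnorm (dot (A y) y) ^+ n) `^ n%:R^-1 = _).
    2: by rewrite -powR_mulrn // -powRrM mulfV // powRr1.
  by apply: ge0_ler_powR; rewrite ?invr_ge0 ?nnegrE ?exprn_ge0 //; exact: AC.
have wC : numerical_radius dot A <= C `^ n%:R^-1.
  apply: ge_sup => [|_ [y /= y1 <-]]; last exact: root_ub.
  by exists (rnorm (dot (A x) x)); exists x.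
have w0 : 0 <= numerical_radius dot A.
  apply: le_trans (rnorm_ge0 (dot (A x) x)) _.
  apply: ub_le_sup; last by exists x.
  by exists (C `^ n%:R^-1) => _ [y /= y1 <-]; exact: root_ub.
suff -> : C = (C `^ n%:R^-1) ^+ n by rewrite lerXn2r // nnegrE powR_ge0.
by rewrite -powR_mulrn ?powR_ge0 // -powRrM mulVf // powRr1.
Qed.

Lemma numerical_radius_id : (exists x : H, x != 0) ->
  numerical_radius dot idfun = 1.
Proof.
move=> /exists_unit_vector[x x1].
rewrite /numerical_radius -[RHS]sup1; congr (sup _).
have dot1 y : rnorm y = 1 -> rnorm (dot y y) = 1.
  by move=> /rnorm_eq1 y1; rewrite dot_norm y1 expr1n /rnorm normr1.
apply/seteqP; split => [_ [y /= y1 <-]|_ ->]; first exact: dot1.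
by exists x => //=; exact: dot1.
Qed.

End NumericalRadius.

Theorem corollary3p5 (R : realType) (H : completeNormedModType R[i])
    (dot : {dot H for conjC}) (dot_norm : induces_norm dot)
    (H_neq0 : exists x : H, x != 0) (n : nat) (n_ge2 : (2 <= n)%N) :
  (forall T : {linear H -> H}, bounded_operator T -> opnorm T <= 1 ->
     numerical_radius dot T ^+ n <=
       1 / 2 ^+ (n - 1) * numerical_radius dot (iter n T)
       + 1 - 1 / 2 ^+ (n - 1)) /\
  (exists T : {linear H -> H},
     [/\ bounded_operator T, opnorm T <= 1 &
         numerical_radius dot T ^+ n =
           1 / 2 ^+ (n - 1) * numerical_radius dot (iter n T)
           + 1 - 1 / 2 ^+ (n - 1)]).
Proof.
have n_eq : n = (n - 1).+1 by rewrite subn1 prednK // ltnW.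
split=> [T Tbnd T1|].
  have Tle := opnorm_le1_contraction Tbnd T1.
  apply: numerical_radius_expr_le => // [|x x1]; first by rewrite ltnW.
  have Tn : rnorm (dot (iter n T x) x) <= numerical_radius dot (iter n T).
    apply: dot_le_numerical_radius => // y; exact: norm_iter_le.
  (* bring the pointwise bound from the complex field down to the reals *)
  have := dot_contraction_expr_le dot_norm (n - 1) Tle (rnorm_eq1 x1).
  rewrite -n_eq !norm_rnorm -(rmorph_nat (real_complex R)).
  rewrite -!(rmorphXn (real_complex R)) -fmorphV -rmorphM.
  rewrite -(rmorph1 (real_complex R)) -rmorphB -rmorphD lecR.
  move=> /le_trans; apply; rewrite !div1r -addrA lerD2r.
  by rewrite ler_wpM2l // invr_ge0 exprn_ge0.
have iter_idfun : iter n (idfun : H -> H) = idfun.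
  by apply/funext => x; elim: n {n_ge2 n_eq} => //= m ->.
have id_bounded : bounded_operator (idfun : H -> H).
  by exists 1 => x; rewrite mul1r.
exists idfun; split => //.
  apply: ge_sup => [|_ [x /= x1 <-]] //.
  by exists (rnorm (0 : H)); exists 0 => //=; rewrite /rnorm normr0.
rewrite iter_idfun numerical_radius_id // expr1n mulr1.
by rewrite addrAC subrr add0r.
Qed.
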